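(* Let $f\colon\mathbb{R}^n\to\mathbb{R}$ be $\rho$-weakly convex for some $\rho>0$, and suppose that, for some $L>0$, $f$ is either $L$-smooth or $L$-Lipschitz. Then, for all $x\in\mathbb{R}^n$ and $t\in(0,1/\rho)$, the proximal $\mathrm{prox}_{tf}(x)$ is unique (i.e. the set of minimizers defining it consists of exactly one point) and, if $u(x,t)\geq 0$, then $$\lim_{\delta\to 0^+}\frac{\mathbb{E}_{y\sim\mathcal{N}(x,\delta t)}\left[y\cdot\exp\left(-f(y)/\delta\right)\right]}{\mathbb{E}_{y\sim\mathcal{N}(x,\delta t)}\left[\exp\left(-f(y)/\delta\right)\right]}=\mathrm{prox}_{tf}(x).$$
   Context: Here $\|\cdot\|$ is the Euclidean norm on $\mathbb{R}^n$. For $\rho>0$, a function $f\colon\mathbb{R}^n\to\mathbb{R}$ is $\rho$-weakly convex if $z\mapsto f(z)+\frac{\rho}{2}\|z\|^2$ is convex. For $L>0$, $f$ is $L$-smooth if its gradient $\nabla f$ exists (everywhere) and is $L$-Lipschitz; $f$ is $L$-Lipschitz if $|f(y)-f(z)|\le L\|y-z\|$ for all $y,z\in\mathbb{R}^n$. For $t>0$ and $x\in\mathbb{R}^n$, the proximal of $f$ is the set of minimizers $\mathrm{prox}_{tf}(x)=\operatorname{argmin}_{z\in\mathbb{R}^n} f(z)+\frac{1}{2t}\|z-x\|^2$ (identified with its element when it is a singleton), and the Moreau envelope of $f$ is $u(x,t)=\min_{z\in\mathbb{R}^n} f(z)+\frac{1}{2t}\|z-x\|^2$. For $\delta>0$,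 $y\sim\mathcal{N}(x,\delta t)$ means that $y\in\mathbb{R}^n$ is sampled from the normal distribution with mean $x$ and standard deviation $\sqrt{\delta t}$, i.e. with covariance matrix $\delta t\, I$, having density $(2\pi\delta t)^{-n/2}\exp(-\|y-x\|^2/(2\delta t))$. *)

(* Defs.v *)
From HB Require Import structures.
From mathcomp Require Import all_boot all_order all_algebra.
From mathcomp Require Import all_classical all_reals all_analysis.
From mathcomp Require Import measurable_realfun.

Set Implicit Arguments.
Unset Strict Implicit.
Unset Printing Implicit Defensive.

Import Order.TTheory GRing.Theory Num.Theory.
Import numFieldNormedType.Exports.

Local Open Scope classical_set_scope.
Local Open Scope ring_scope.

Section Euclidean.
Context {R : realType} {n : nat}.
Implicit Types (f : 'rV[R]_n -> R) (x y z : 'rV[R]_n) (L rho t : R).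

(* The library's norm [`|x|] on row vectors is the sup norm. It induces the same
   topology, hence the same limits and derivatives, as the Euclidean norm. *)
Definition enorm x : R := Num.sqrt (\sum_(i < n) x 0 i ^+ 2).

Definition weakly_convex rho f : Prop :=
  convex_function setT (fun z => f z + rho / 2 * enorm z ^+ 2).

(* The vector of partial derivatives; it represents ['d f x] for the Euclidean
   inner product when [f] is differentiable at [x]. *)
Definition gradient f x : 'rV[R]_n := \row_(i < n) 'D_(delta_mx 0 i) f x.

Definition L_smooth L f : Prop :=
  (forall x, differentiable f x) /\
  (forall y z, enorm (gradient f y - gradient f z) <= L * enorm (y - z)).

Definition L_lipschitz L f : Prop :=
  forall y z, `|f y - f z| <= L * enorm (y - z).

Definition prox_objective t f x z : R := f z + (2 * t)^-1 * enorm (z - x) ^+ 2.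

Definition prox t f x : set 'rV[R]_n :=
  [set z | forall w, prox_objective t f x z <= prox_objective t f x w].

(* The infimum of the objective; by [moreau_envelopeE] it is the minimum as soon
   as the minimum is attained. *)
Definition moreau_envelope f x t : R := inf (range (prox_objective t f x)).

Lemma moreau_envelopeE f x t z :
  prox t f x z -> moreau_envelope f x t = prox_objective t f x z.
Proof.
move=> pz; apply/eqP; rewrite eq_le; apply/andP; split.
- apply: ge_inf; last by exists z.
  by exists (prox_objective t f x z) => _ [w _ <-]; exact: pz.
- by apply: lb_le_inf; [exists (prox_objective t f x z), z|move=> _ [w _ <-]; exact: pz].
Qed.

End Euclidean.

(* The coordinate (product) sigma-algebra on R^n, i.e. its Borel sigma-algebra. *)
Section measurable_rV.
Context {R : realType} (n : nat).

Let coord (i : 'I_n) (x : 'rV[R]_n) : measurableTypeR R := x 0 i.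

Let rV_set0 : g_sigma_preimage coord set0.
Proof. exact: sigma_algebra0. Qed.

Let rV_setC A : g_sigma_preimage coord A -> g_sigma_preimage coord (~` A).
Proof. exact: sigma_algebraC. Qed.

Let rV_bigcup (F : _^nat) : (forall i, g_sigma_preimage coord (F i)) ->
  g_sigma_preimage coord (\bigcup_i (F i)).
Proof. exact: sigma_algebra_bigcup. Qed.

HB.instance Definition _ := @isMeasurable.Build default_measure_display
  'rV[R]_n (g_sigma_preimage coord) rV_set0 rV_setC rV_bigcup.

Lemma measurable_coord (i : 'I_n) :
  measurable_fun [set: 'rV[R]_n] (fun x => x 0 i : measurableTypeR R).
Proof.
move=> _ Y mY; rewrite setTI; apply: sub_sigma_algebra => /=.
rewrite -bigcup_seq/=; exists i => /=; first by rewrite mem_index_enum.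
by exists Y => //; rewrite setTI.
Qed.

Lemma measurable_fun_coordP d (T : measurableType d) (f : T -> 'rV[R]_n) :
  (forall i, measurable_fun [set: T] (fun w => f w 0 i : measurableTypeR R)) ->
  measurable_fun [set: T] f.
Proof.
move=> mf.
suff : g_sigma_preimage (fun i => coord i \o f) `<=` measurable.
  rewrite g_sigma_preimage_comp => h _ A mA; apply: h; by exists A.
apply: smallest_sub; first exact: sigma_algebra_measurable.
rewrite -bigcup_seq; apply: bigcup_sub => i _.
by move=> A [B mB <-]; exact: mf.
Qed.

End measurable_rV.

Section lebesgue_rV.
Context {R : realType}.

Definition row_cons n (p : measurableTypeR R * 'rV[R]_n) : 'rV[R]_n.+1 :=
  row_mx (const_mx p.1 : 'rV[R]_1) p.2.

Lemma row_cons0 n (p : measurableTypeR R * 'rV[R]_n) : row_cons p 0 ord0 = p.1.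
Proof.
have -> : ord0 = lshift n (ord0 : 'I_1) by exact/val_inj.
by rewrite [LHS]row_mxEl mxE.
Qed.

Lemma row_consS n (p : measurableTypeR R * 'rV[R]_n) (i : 'I_n) :
  row_cons p 0 (lift ord0 i) = p.2 0 i.
Proof.
have -> : lift ord0 i = rshift 1 i by exact/val_inj.
by rewrite [LHS]row_mxEr.
Qed.

Lemma measurable_row_cons n : measurable_fun setT (@row_cons n).
Proof.
apply: measurable_fun_coordP => i.
have [j ->|->] := unliftP ord0 i.
- under eq_fun do rewrite row_consS.
  exact: (measurableT_comp (measurable_coord j) measurable_snd).
- under eq_fun do rewrite row_cons0.
  exact: measurable_fst.
Qed.

Fixpoint lebesgue_rV (n : nat) : set 'rV[R]_n -> \bar R :=
  match n with
  | 0 => dirac (0 : 'rV[R]_0)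
  | n.+1 => pushforward (lebesgue_measure \x lebesgue_rV (n := n))%E (@row_cons n)
  end.

Let lebesgue_rV_ind n : {mu : {sigma_finite_measure set 'rV[R]_n -> \bar R} |
  mu = @lebesgue_rV n :> (set 'rV[R]_n -> \bar R)}.
Proof.
elim: n => [|n [mu muE]].
  by exists (dirac (0 : 'rV[R]_0)).
pose nu : {measure set 'rV[R]_n.+1 -> \bar R} :=
  measure_function_pushforward__canonical__measure_function_Measure
    (lebesgue_measure \x mu)%E (@measurable_row_cons n).
suff snu : sigma_finite setT nu.
  pose m := Measure_isSigmaFinite.Build _ _ _ (nu : set _ -> _) snu.
  pose nu' : {sigma_finite_measure set 'rV[R]_n.+1 -> \bar R} :=
    HB.pack (nu : set _ -> _) (Measure.class nu) m.
  by exists nu'; rewrite /= -muE.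
have /sigma_finiteP[F [FT ndF Foo]] := sigma_finiteT (@lebesgue_measure R).
have /sigma_finiteP[G [GT ndG Goo]] := sigma_finiteT mu.
have rcK : cancel (@row_cons n)
    (fun x => (x 0 ord0, \row_i x 0 (lift ord0 i)) : measurableTypeR R * 'rV[R]_n).
  move=> [a v]; rewrite row_cons0; congr pair.
  by apply/rowP => i; rewrite mxE row_consS.
set h := fun x => _ in rcK.
have mh : measurable_fun [set: 'rV[R]_n.+1] h.
  apply: measurable_fun_pair; first exact: measurable_coord.
  apply: measurable_fun_coordP => i; under eq_fun do rewrite mxE.
  exact: measurable_coord.
exists (fun k => h @^-1` (F k `*` G k)).
  rewrite -preimage_bigcup; apply/esym; rewrite -subTset => x _ /=.
  have [i _ Fi] : (\bigcup_k F k) (h x).1 by rewrite -FT.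
  have [j _ Gj] : (\bigcup_k G k) (h x).2 by rewrite -GT.
  exists (maxn i j) => //; split.
  - by move: Fi; exact/subsetPset/ndF/leq_maxl.
  - by move: Gj; exact/subsetPset/ndG/leq_maxr.
move=> k; have [mF Fk] := Foo k; have [mG Gk] := Goo k; split.
  by rewrite -[X in measurable X]setTI; apply: mh => //; exact: measurableX.
rewrite /= /pushforward -comp_preimage.
rewrite (_ : h \o _ = id); last by apply/funext => p /=; rewrite rcK.
by rewrite preimage_id product_measure1E// lte_mul_pinfty// ge0_fin_numE.
Qed.

Let lebesgue_rV0 n : @lebesgue_rV n set0 = 0%E.
Proof. by have [mu <-] := lebesgue_rV_ind n; exact: measure0. Qed.

Let lebesgue_rV_ge0 n A : (0 <= @lebesgue_rV n A)%E.
Proof. by have [mu <-] := lebesgue_rV_ind n; exact: measure_ge0. Qed.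

Let lebesgue_rV_sigma_additive n : semi_sigma_additive (@lebesgue_rV n).
Proof.
by have [mu <-] := lebesgue_rV_ind n; exact: measure_semi_sigma_additive.
Qed.

HB.instance Definition _ n := isMeasure.Build _ _ _ (@lebesgue_rV n)
  (lebesgue_rV0 n) (@lebesgue_rV_ge0 n) (@lebesgue_rV_sigma_additive n).

Let lebesgue_rV_sigma_finite n : sigma_finite setT (@lebesgue_rV n).
Proof. by have [mu <-] := lebesgue_rV_ind n; exact: sigma_finiteT. Qed.

HB.instance Definition _ n := Measure_isSigmaFinite.Build _ _ _ (@lebesgue_rV n)
  (lebesgue_rV_sigma_finite n).

Lemma lebesgue_rV_box n (A : 'I_n -> set (measurableTypeR R)) :
  (forall i, measurable (A i)) ->
  lebesgue_rV [set x | forall i, A i (x 0 i)] =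
  (\prod_(i < n) lebesgue_measure (A i))%E.
Proof.
elim: n A => [|n IHn] A mA.
  by rewrite big_ord0 /= diracE mem_set// => -[].
rewrite big_ord_recl -IHn// -product_measure1E//; last first.
  rewrite [X in measurable X](_ : _ = \bigcap_(i in [set: 'I_n])
    ((fun x : 'rV[R]_n => x 0 i : measurableTypeR R) @^-1` A (lift ord0 i))).
    apply: fin_bigcap_measurable => // i _.
    by rewrite -[X in measurable X]setTI; exact: measurable_coord.
  by apply/seteqP; split => [y h i _|y h i]; [exact: h|exact: (h i)].
rewrite /= /pushforward; congr (product_measure1 _ _ _).
apply/seteqP; split => [p /= h|p [h0 h] i].
  split => [|i]; first by have := h ord0; rewrite row_cons0.
  by have := h (lift ord0 i); rewrite row_consS.
have [j ->|->] := unliftP ord0 i; first by rewrite row_consS; exact: h.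
by rewrite row_cons0.
Qed.

End lebesgue_rV.

Section normal_rV.
Context {R : realType} {n : nat}.
Implicit Types (x y : 'rV[R]_n) (v : R).

Definition normal_rV_pdf x v y : R :=
  (2 * pi * v) `^ (- (n%:R / 2)) * expR (- (enorm (y - x) ^+ 2 / (2 * v))).

(* The isotropic normal distribution N(x, v I); [v] is the variance of each
   coordinate, and the total mass is 1 for [0 < v] by [normal_rV_setT]. *)
Definition normal_rV x v : set 'rV[R]_n -> \bar R :=
  fun A => (\int[@lebesgue_rV R n]_(y in A) (normal_rV_pdf x v y)%:E)%E.

Lemma normal_rV_pdf_ge0 x v y : 0 <= normal_rV_pdf x v y.
Proof. by rewrite mulr_ge0 ?powR_ge0 ?expR_ge0. Qed.

Lemma measurable_enorm : measurable_fun [set: 'rV[R]_n] (@enorm R n).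
Proof.
apply: (@measurableT_comp _ _ _ _ _ _ (@Num.sqrt R)).
  by apply: continuous_measurable_fun; exact: sqrt_continuous.
apply: measurable_sum => i.
exact: (measurable_funX 2 (measurable_coord i)).
Qed.

Lemma measurable_normal_rV_pdf x v : measurable_fun setT (normal_rV_pdf x v).
Proof.
apply: measurable_funM => //; apply: measurableT_comp => //=.
apply: measurableT_comp => //=; apply: measurable_funM => //=.
apply: measurable_funX; apply: (measurableT_comp measurable_enorm).
apply: measurable_fun_coordP => i; under eq_fun do rewrite !mxE.
by apply: measurable_funB => //; exact: measurable_coord.
Qed.

Let normal_rV0 x v : normal_rV x v set0 = 0%E.
Proof. by rewrite /normal_rV integral_set0. Qed.

Let normal_rV_ge0 x v A : (0 <= normal_rV x v A)%E.
Proof. by apply: integral_ge0 => y _; rewrite lee_fin normal_rV_pdf_ge0. Qed.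

Let normal_rV_sigma_additive x v : semi_sigma_additive (normal_rV x v).
Proof.
move=> F mF tF mUF; rewrite /normal_rV ge0_integral_bigcup//=; last 2 first.
- apply: measurable_funTS; apply/measurable_EFinP.
  exact: measurable_normal_rV_pdf.
- by move=> y _; rewrite lee_fin normal_rV_pdf_ge0.
apply: is_cvg_ereal_nneg_natsum_cond => k _ _.
exact: normal_rV_ge0.
Qed.

HB.instance Definition _ x v := isMeasure.Build _ _ _ (normal_rV x v)
  (normal_rV0 x v) (@normal_rV_ge0 x v) (@normal_rV_sigma_additive x v).

End normal_rV.

Lemma normal_rV_pdf_row_cons {R : realType} n (x : 'rV[R]_n.+1) (v : R) p :
  0 < v ->
  normal_rV_pdf x v (row_cons p) =
  normal_pdf (x 0 ord0) (Num.sqrt v) p.1 *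
  normal_rV_pdf (\row_i x 0 (lift ord0 i)) v p.2.
Proof.
move=> v0; rewrite /normal_rV_pdf normal_pdfE ?gt_eqF ?sqrtr_gt0//.
rewrite /normal_peak /normal_fun mulrACA; congr (_ * _).
  rewrite sqr_sqrtr ?ltW// -powR12_sqrt; last first.
    by rewrite mulrn_wge0// mulr_ge0 ?pi_ge0// ltW.
  rewrite -powRN (_ : v * pi *+ 2 = 2 * pi * v); last first.
    by rewrite -mulr_natl (mulrC v) mulrA.
  rewrite -powRD; last first.
    by apply/implyP => _; rewrite gt_eqF// !mulr_gt0 ?pi_gt0.
  by congr powR; rewrite -natr1 mulrDl mul1r opprD addrC.
rewrite -expRD; congr expR.
have subE i : (row_cons p - x) 0 i = row_cons p 0 i - x 0 i.
  by rewrite mxE [X in _ + X]mxE.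
rewrite /enorm (sqr_sqrtr (ltW v0)) !sqr_sqrtr; last 2 first.
- by apply: sumr_ge0 => i _; rewrite sqr_ge0.
- by apply: sumr_ge0 => i _; rewrite sqr_ge0.
rewrite big_ord_recl mulrDl opprD -(mulr_natl v) mulNr; congr (- _ + _).
  by rewrite subE row_cons0.
congr (- (_ / _)); apply: eq_bigr => i _.
by rewrite subE row_consS !mxE.
Qed.

Lemma normal_rV_setT {R : realType} n (x : 'rV[R]_n) (v : R) :
  0 < v -> normal_rV x v setT = 1%E.
Proof.
move=> v0; elim: n x => [|n IHn] x; rewrite /normal_rV.
  rewrite /= integral_dirac//; last first.
    apply/measurable_EFinP; exact: measurable_normal_rV_pdf.
  rewrite diracT mul1e /normal_rV_pdf /enorm big_ord0 sqrtr0.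
  by rewrite mul0r oppr0 powRr0 expr0n/= mul0r oppr0 expR0 mulr1.
have mpdf := measurable_normal_rV_pdf x v.
have := @ge0_integral_pushforward _ _ _ _ R (@row_cons R n)
  (@measurable_row_cons R n) (lebesgue_measure \x @lebesgue_rV R n)%E setT
  (EFin \o normal_rV_pdf x v) measurableT.
move=> ->; first last.
- by move=> y _; rewrite /= lee_fin normal_rV_pdf_ge0.
- exact/measurable_EFinP.
rewrite preimage_setT fubini_tonelli1//=; first last.
- by move=> p; rewrite lee_fin normal_rV_pdf_ge0.
- by apply/measurable_EFinP; apply: measurableT_comp => //; exact: measurable_row_cons.
rewrite /fubini_F.
transitivity (\int[lebesgue_measure]_a (normal_pdf (x 0 ord0) (Num.sqrt v) a)%:E)%E;
  last exact: integral_normal_pdf.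
apply: eq_integral => a _.
under eq_integral => y _ do rewrite /= normal_rV_pdf_row_cons// EFinM /=.
rewrite ge0_integralZl//=; first last.
- by rewrite lee_fin normal_pdf_ge0.
- by move=> y _; rewrite lee_fin normal_rV_pdf_ge0.
- by apply/measurable_EFinP; exact: measurable_normal_rV_pdf.
by rewrite [X in (_ * X)%E](IHn (\row_i x 0 (lift ord0 i))) mule1.
Qed.

Section expectation.
Context {R : realType} {n : nat}.
Implicit Types (x : 'rV[R]_n) (v : R).

(* [Rintegral] takes the junk value 0 when the Lebesgue integral is infinite, so
   these are the expectations only for integrable [g]. *)
Definition normal_expectation x v (g : 'rV[R]_n -> R) : R :=
  \int[normal_rV x v]_y g y.

Definition normal_expectation_rV x v (g : 'rV[R]_n -> 'rV[R]_n) : 'rV[R]_n :=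
  \row_(i < n) normal_expectation x v (fun y => g y 0 i).

End expectation.

(* Main.v *)
(* For [t < 1 / rho] the objective [phi] of the proximal is strongly convex and
   continuous, so it has a minimizer [p], with [phi y >= phi p + k |y - p|^2];
   hence [p] is unique. The density of N(x, delta t) times [exp (- f / delta)] is
   a constant times [exp (- phi / delta)], so the quotient of expectations is the
   mean of the probability density proportional to [exp (- (phi - phi p) / delta)],
   which concentrates at [p] by Laplace's method: the quadratic growth bounds the
   mass at distance [>= e] from [p] by [O (exp (- k e^2 / (2 delta)))], while
   continuity at [p] bounds the total mass from below by a multiple of
   [exp (- k e^2 / (4 delta))]. *)
Require Import Defs.
From mathcomp Require Import all_boot all_order all_algebra.
From mathcomp Require Import all_classical all_reals all_analysis.
From mathcomp Require Import measurable_realfun ring lra.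
Import Order.TTheory GRing.Theory Num.Theory.
Import numFieldNormedType.Exports.
Local Open Scope classical_set_scope.
Local Open Scope ring_scope.

(** * The Euclidean norm compared with the sup norm *)

Section enorm_theory.
Context {R : realType} {n : nat}.
Implicit Types x y z : 'rV[R]_n.

Lemma enorm_ge0 x : 0 <= enorm x.
Proof. exact: sqrtr_ge0. Qed.

Lemma sqr_enorm x : enorm x ^+ 2 = \sum_(i < n) x 0 i ^+ 2.
Proof. by rewrite sqr_sqrtr// sumr_ge0// => i _; rewrite sqr_ge0. Qed.

Lemma enorm0 : enorm (0 : 'rV[R]_n) = 0.
Proof. by rewrite /enorm big1 ?sqrtr0// => i _; rewrite mxE expr0n. Qed.

Lemma enormZ (k : R) x : enorm (k *: x) = `|k| * enorm x.
Proof.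
rewrite /enorm -sqrtr_sqr -sqrtrM ?sqr_ge0// mulr_sumr.
by congr Num.sqrt; apply: eq_bigr => i _; rewrite mxE exprMn.
Qed.

Lemma le_coord_enorm x i : `|x 0 i| <= enorm x.
Proof.
rewrite -[leLHS]sqrtr_sqr ler_sqrt ?sumr_ge0//.
  by rewrite (bigD1 i)//= lerDl sumr_ge0// => j _; rewrite sqr_ge0.
by move=> j _; rewrite sqr_ge0.
Qed.

Lemma le_mx_norm_coord x (e : R) :
  0 <= e -> (forall i, `|x 0 i| <= e) -> `|x| <= e.
Proof.
move=> e0 xe; rewrite [leLHS]/Num.Def.normr/= mx_normrE (bigmax_le _ e0)//= => -[i j] _.
by rewrite /= (ord1 i).
Qed.

Lemma le_norm_enorm x : `|x| <= enorm x.
Proof. by apply: le_mx_norm_coord => [|i]; rewrite ?enorm_ge0 ?le_coord_enorm. Qed.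

Lemma enorm_eq0 x : enorm x = 0 -> x = 0.
Proof. by move=> x0; apply/eqP; rewrite -normr_le0 -x0 le_norm_enorm. Qed.

Lemma continuous_enorm : continuous (@enorm R n).
Proof.
have cs : continuous (fun y : 'rV[R]_n => \sum_(i < n) y 0 i ^+ 2).
  apply: continuous_big => [|i _ x]; first exact: add_continuous.
  exact: (continuous_comp (@coord_continuous _ _ _ 0 i x) (@exprn_continuous _ 2 _)).
by move=> x; exact: (continuous_comp (@cs x) (@sqrt_continuous _ _)).
Qed.

(* Unification unfolds [nbhs] on matrices, after which its filter instance is not
   found: hence the explicit [F := nbhs _] here and below. *)
Lemma continuous_enormB x : continuous (fun y => enorm (y - x)).
Proof.
move=> y; apply: (@continuous_comp _ _ _ (fun y => y - x) enorm).
  by apply: (cvgB (F := nbhs y)); [exact: cvg_id|exact: cvg_cst].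
exact: continuous_enorm.
Qed.

(** The exact convexity defect of the squared norm; it lets quadratic terms be added to and removed
    from convexity inequalities. *)
Lemma sqr_enorm_conv (s : R) x y :
  enorm (s *: x + (1 - s) *: y) ^+ 2 =
  s * enorm x ^+ 2 + (1 - s) * enorm y ^+ 2 - s * (1 - s) * enorm (x - y) ^+ 2.
Proof.
rewrite !sqr_enorm !mulr_sumr -big_split -sumrB/=; apply: eq_bigr => i _.
by rewrite !mxE; ring.
Qed.

(** Boundedness in the library norm follows from [le_norm_enorm], closedness from continuity of
    [enorm]. *)
Lemma compact_enorm_ball x (r : R) : compact [set z | enorm (z - x) <= r].
Proof.
apply: bounded_closed_compact.
  exists (r + `|x|); split; first exact: num_real.
  move=> M rM z /= zr; rewrite (le_trans _ (ltW rM))//.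
  rewrite -(subrK x z) (le_trans (ler_normD _ _))// lerD2r.
  exact: le_trans (le_norm_enorm _) zr.
rewrite (_ : mkset _ = (fun z => enorm (z - x)) @^-1` [set u | u <= r])//.
apply: preimage_closed; last exact: closed_le.
by move=> z _; exact: continuous_enormB.
Qed.

End enorm_theory.

(** * Strong convexity, existence of minimizers and quadratic growth *)

Section strong_convexity.
Context {R : realType} {n : nat}.
Implicit Types (rho t c : R) (x y z w p : 'rV[R]_n) (phi f : 'rV[R]_n -> R).

(** In the usual normalization the modulus is [2 * c]: the condition says that
    [phi - c * enorm ^+ 2] is convex. *)
Definition strongly_convex (c : R) phi := forall (s : R) z w, 0 <= s <= 1 ->
  phi (s *: z + (1 - s) *: w) <=
  s * phi z + (1 - s) * phi w - c * (s * (1 - s)) * enorm (z - w) ^+ 2.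

(** Up to an affine term, the objective is the convex function [f + rho / 2 * enorm ^+ 2] plus
    [(t^-1 - rho) / 2 * enorm ^+ 2]. *)
Lemma strongly_convex_prox_objective rho t f x : 0 < t ->
  weakly_convex rho f ->
  strongly_convex ((t^-1 - rho) / 2) (prox_objective t f x).
Proof.
move=> t0 fwc s z w /andP[s0 s1]; rewrite /prox_objective.
have := fwc (@Itv01 R s s0 s1) z w; rewrite !inE => /(_ I I).
rewrite convRE /conv /=.
have -> : s *: z + (1 - s) *: w - x = s *: (z - x) + (1 - s) *: (w - x).
  by apply/rowP => i; rewrite !mxE; ring.
rewrite !sqr_enorm_conv.
have -> : z - x - (w - x) = z - w by rewrite opprB addrA subrK.
rewrite -[unstable.onem s]/(1 - s) invfM; lra.
Qed.

(* If [q] minimizes [phi] on the unit ball around [x], strong convexity on the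
   segment [x, z], evaluated where it crosses the unit sphere, gives [phi x <= phi z]
   as soon as [z] lies outside a ball of explicit radius [S]. *)
Lemma strongly_convex_argmin c phi x : 0 < c -> continuous phi ->
  strongly_convex c phi -> exists p, forall z, phi p <= phi z.
Proof.
move=> c0 cphi scphi.
have ballmin (r : R) : 0 <= r -> exists p, enorm (p - x) <= r /\
    forall z, enorm (z - x) <= r -> phi p <= phi z.
  move=> r0; have [|p pr pmin] :=
    EVT_min_rV _ (compact_enorm_ball x r) (continuous_subspaceT cphi).
    by exists x; rewrite /= subrr enorm0.
  rewrite inE in pr; exists p; split => // z zr; apply: pmin; exact/mem_set.
have [q [_ qmin]] := ballmin 1 ler01.
have qx : phi q <= phi x by apply: qmin; rewrite subrr enorm0.
(* For [r >= S] one has [phi x - phi q <= c * (r - 1)]: the gain from strong convexity outweighs the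
   possible descent inside the unit ball. *)
pose S := 1 + (phi x - phi q) / c.
have S1 : 1 <= S by rewrite lerDl divr_ge0 ?subr_ge0// ltW.
have [p [_ pmin]] := ballmin S (le_trans ler01 S1).
exists p => z; have [/pmin//|/ltW zS] := leP (enorm (z - x)) S.
apply: (le_trans (pmin x _)); first by rewrite subrr enorm0 (le_trans ler01 S1).
set r := enorm (z - x) in zS *.
have r1 : 1 <= r by exact: le_trans zS.
have r0 : 0 < r by exact: lt_le_trans r1.
have := scphi r^-1 z x; rewrite invr_ge0 (ltW r0) invf_le1// r1 => /(_ isT).
have : phi q <= phi (r^-1 *: z + (1 - r^-1) *: x).
  apply: qmin; rewrite (_ : _ - x = r^-1 *: (z - x)); last first.
    by apply/rowP => i; rewrite !mxE; ring.
  by rewrite enormZ gtr0_norm ?invr_gt0// mulVf ?gt_eqF.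
move=> /le_trans/[apply]; rewrite -/r -(ler_pM2l r0).
have -> : r * (r^-1 * phi z + (1 - r^-1) * phi x -
    c * (r^-1 * (1 - r^-1)) * r ^+ 2) =
  phi z + (r - 1) * phi x - c * (r - 1) * r by field; rewrite gt_eqF.
have : (phi x - phi q) * r <= c * (r - 1) * r.
  by rewrite ler_pM2r// mulrC -ler_pdivrMr// lerBrDl.
lra.
Qed.

(** Strong convexity at the midpoint of [z] and [p], where [phi] is at least [phi p]. *)
Lemma strongly_convex_growth c phi p : strongly_convex c phi ->
  (forall z, phi p <= phi z) ->
  forall z, phi p + c / 2 * enorm (z - p) ^+ 2 <= phi z.
Proof.
move=> scphi pmin z.
have := scphi 2^-1 z p; rewrite invr_ge0 invf_le1// ler0n ler1n => /(_ isT).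
move=> /(le_trans (pmin _)); lra.
Qed.

End strong_convexity.

(** * Continuity of the objective *)

Section continuity.
Context {R : realType} {n : nat}.
Implicit Types (f : 'rV[R]_n -> R).

Lemma L_lipschitz_continuous (L : R) f : L_lipschitz L f -> continuous f.
Proof.
move=> fL x; apply/(@cvgrPdist_le _ _ _ (nbhs x)) => e e0.
have : (fun y => L * enorm (y - x)) @ x --> L * enorm (x - x).
  by apply: (cvgMl_tmp (F := nbhs x)); exact: continuous_enormB.
rewrite subrr enorm0 mulr0 => /(@cvgrPdist_le _ _ _ (nbhs x))/(_ _ e0); apply: filterS => y.
by rewrite sub0r normrN distrC => /(le_trans (ler_norm _)); exact: le_trans.
Qed.

Lemma continuous_prox_objective t f x :
  continuous f -> continuous (prox_objective t f x).
Proof.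
move=> cf z; apply: (cvgD (F := nbhs z)); first exact: cf.
apply: (cvgMl_tmp (F := nbhs z)).
exact: (continuous_comp (@continuous_enormB _ _ x z) (@exprn_continuous _ 2 _)).
Qed.

End continuity.

(** * Open sets belong to the coordinate sigma-algebra *)

Section borel_rV.
Context {R : realType} {n : nat}.

Lemma measurable_box (A : 'I_n -> set (measurableTypeR R)) :
  (forall i, measurable (A i)) ->
  measurable [set y : 'rV[R]_n | forall i, A i (y 0 i)].
Proof.
move=> mA; rewrite [X in measurable X](_ : _ = \bigcap_(i in [set: 'I_n])
  ((fun y : 'rV[R]_n => y 0 i : measurableTypeR R) @^-1` A i)).
  apply: fin_bigcap_measurable => // i _.
  by rewrite -[X in measurable X]setTI; exact: measurable_coord.
by apply/seteqP; split => [y h i _|y h i]; [exact: h|exact: (h i)].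
Qed.

(** An open set is the union of the countably many rational cubes that it contains, and cubes are
    measurable coordinatewise. *)
Lemma open_measurable_rV (U : set 'rV[R]_n) : open U -> measurable U.
Proof.
move=> oU.
pose box (q : 'rV[rat]_n * rat) : set 'rV[R]_n :=
  [set y | forall i, `|ratr (q.1 0 i) - y 0 i| < ratr q.2].
have mbox q : measurable (box q).
  by apply: (measurable_box (fun i => ball (ratr (q.1 0 i) : R) (ratr q.2))) => i;
    exact: measurable_ball.
rewrite (_ : U = \bigcup_q (if pselect (box q `<=` U) then box q else set0)).
  apply: countable_bigcupT_measurable => // q.
  by case: pselect => /= _; last exact: measurable0.
apply/seteqP; split => [y Uy|y [q _]]; last first.
  by case: pselect => //= qU qy; exact: qU.
have /nbhs_ballP[_ /posnumP[e] eU] : nbhs y U by exact: open_nbhs_nbhs.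
(* A rational cube of radius [d < e / 2] whose centre is within [d] of [y] contains [y] and stays
   within [2 d < e] of it. *)
have e20 : 0 < e%:num / 2 :> R by [].
have [d] := rat_in_itvoo e20; rewrite in_itv/= => /andP[d0 de].
have qi i : {q : rat | `|ratr q - y 0 i| < ratr d}.
  apply: cid; have : y 0 i - ratr d < y 0 i + ratr d by lra.
  move=> /rat_in_itvoo[q]; rewrite in_itv/= => /andP[q1 q2].
  by exists q; rewrite ltr_norml; apply/andP; split; lra.
exists (\row_i sval (qi i), d) => //.
case: pselect => /= [_ i|]; first by rewrite mxE; exact: (svalP (qi i)).
case=> z /= bz; apply: eU; split=> // i j; rewrite (ord1 i).
have := bz j; have := svalP (qi j); rewrite mxE /= -/(ball _ _ _).
rewrite /ball/= => + h; rewrite distrC => /ltr_leD /(_ (ltW h)).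
move=> /(le_lt_trans (ler_distD _ _ _)) /lt_le_trans; apply.
by lra.
Qed.

Lemma continuous_measurable_fun_rV (f : 'rV[R]_n -> R) :
  continuous f -> measurable_fun setT f.
Proof.
move=> /continuousP cf; apply: (measurability _ (RGenOpens.measurableE R)).
move=> _ [_ [a [b ->] <-]]; rewrite setTI; apply: open_measurable_rV.
by apply: cf; exact: interval_open.
Qed.

End borel_rV.

(** * Integration against a measure with a density *)

Section density.
Local Open Scope ereal_scope.
Context d (T : measurableType d) (R : realType).
Variables (mu nu : {measure set T -> \bar R}) (g : T -> R).
Hypotheses (g0 : forall x, (0 <= g x)%R) (mg : measurable_fun setT g).
Hypothesis nuE : forall A, measurable A -> nu A = \int[mu]_(x in A) (g x)%:E.

Import HBNNSimple.

Let nnsfun_integral_density (h : {nnsfun T >-> R}) :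
  \int[nu]_x (h x)%:E = \int[mu]_x ((h x)%:E * (g x)%:E).
Proof.
rewrite integralT_nnsfun sintegralE.
have measurable_1g y :
    measurable_fun setT (fun x => (\1_(h @^-1` [set y]) x)%:E * (g x)%:E).
  apply: emeasurable_funM; apply/measurable_EFinP => //.
transitivity (\int[mu]_x
    (\sum_(y \in range h) (y%:E * ((\1_(h @^-1` [set y]) x)%:E * (g x)%:E)))).
  rewrite ge0_integral_fsum//; last 2 first.
  - by move=> y; exact: emeasurable_funM.
  (* Here [y] is an arbitrary real; a nonzero indicator forces [y = h x], which is nonnegative. *)
  - move=> y x _.
    have [->|y0] := eqVneq y 0%R; first by rewrite mul0e.
    rewrite indicE; case: (boolP (x \in _)) => [|_]; last by rewrite mul0e mule0.
    by rewrite inE => /= <-; rewrite mul1e mule_ge0// lee_fin.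
  apply: eq_fsbigr => y /[!inE] -[z _ <-].
  rewrite ge0_integralZl//; last 2 first.
  - by move=> x _; rewrite mule_ge0 ?lee_fin.
  - by rewrite lee_fin.
  rewrite nuE//; congr (_ * _); rewrite integral_mkcond; apply: eq_integral => x _.
  by rewrite patchE indicE; case: ifPn; rewrite ?mul1e ?mul0e.
apply: eq_integral => x _; rewrite [in RHS]fimfunE -EFinM.
rewrite !fsbig_finite//= mulr_suml -sumEFin; apply: eq_bigr => y _.
by rewrite -!EFinM mulrA.
Qed.

(** Monotone convergence on both sides, along simple functions increasing to [f]. *)
Lemma ge0_integral_density (f : T -> \bar R) : (forall x, 0 <= f x) ->
  measurable_fun setT f -> \int[nu]_x f x = \int[mu]_x (f x * (g x)%:E).
Proof.
move=> f0 mf; pose h := nnsfun_approx measurableT mf.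
have hf x : (h k x)%:E @[k --> \oo] --> f x by exact: cvg_nnsfun_approx.
have hnd x : {homo (fun k => (h k x)%:E) : a b / (a <= b)%N >-> a <= b}.
  by move=> a b ab; rewrite lee_fin; exact/lefP/nd_nnsfun_approx.
have mh k : measurable_fun setT (fun x => (h k x)%:E) by exact/measurable_EFinP.
have hg x : (h k x)%:E * (g x)%:E @[k --> \oo] --> f x * (g x)%:E.
  by apply: cvgeZr.
under eq_integral do rewrite -(cvg_lim _ (hf _))//.
under [in RHS]eq_integral do rewrite -(cvg_lim _ (hg _))//.
rewrite !monotone_convergence//.
- by under eq_fun do rewrite nnsfun_integral_density.
- by move=> k; apply: emeasurable_funM => //; exact/measurable_EFinP.
- by move=> k x _; rewrite mule_ge0// lee_fin.
- by move=> x _ a b ab; rewrite lee_wpmul2r ?lee_fin//; exact: hnd.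
- by move=> k x _; rewrite lee_fin.
Qed.

Lemma integral_density (f : T -> \bar R) : measurable_fun setT f ->
  \int[nu]_x f x = \int[mu]_x (f x * (g x)%:E).
Proof.
move=> mf; rewrite integralE [RHS]integralE.
rewrite !ge0_integral_density//; [|exact: measurable_funeneg|exact: measurable_funepos].
congr (_ - _); apply: eq_integral => x _.
  by rewrite !funeposE maxe_pMl ?mul0e ?lee_fin.
by rewrite !funenegE -mulNe maxe_pMl ?mul0e ?lee_fin.
Qed.

End density.

(** * Gaussian bounds for Laplace's method *)

Section laplace.
Context {R : realType} {n : nat}.
Implicit Types (x y p : 'rV[R]_n) (psi : 'rV[R]_n -> R).
Local Notation mu := (@lebesgue_rV R n).

(** The function is a constant multiple of the normal density of variance [(2 * k)^-1], whose total
    mass is 1. *)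
Lemma integrable_gauss (k : R) p : 0 < k ->
  mu.-integrable setT (fun y => (expR (- (k * enorm (y - p) ^+ 2)))%:E).
Proof.
move=> k0; pose v := (2 * k)^-1; have v0 : 0 < v by rewrite invr_gt0 mulr_gt0.
pose C : R := (2 * pi * v) `^ (- (n%:R / 2)).
have C0 : 0 < C by rewrite powR_gt0// !mulr_gt0// pi_gt0.
have int_pdf : mu.-integrable setT (fun y => (normal_rV_pdf p v y)%:E).
  apply/integrableP; split; first by apply/measurable_EFinP; exact: measurable_normal_rV_pdf.
  under eq_integral do rewrite abse_EFin ger0_norm ?normal_rV_pdf_ge0//.
  by have := normal_rV_setT p v0; rewrite /normal_rV => ->; rewrite ltry.
apply: (@eq_integrable _ _ _ mu _ measurableT
  (fun y => (C^-1)%:E * (normal_rV_pdf p v y)%:E)%E) => //.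
  move=> y _; rewrite -EFinM /normal_rV_pdf mulKf ?gt_eqF//.
  by congr (expR (- _))%:E; rewrite /v; field; rewrite gt_eqF.
exact: integrableZl.
Qed.

Lemma lebesgue_rV_cube p (r : R) : 0 <= r ->
  mu [set y | forall i, y 0 i \in `[p 0 i - r, p 0 i + r]] = ((2 * r) ^+ n)%:E.
Proof.
move=> r0.
rewrite (@lebesgue_rV_box R n
  (fun i => [set` `[p 0 i - r, p 0 i + r]] : set (measurableTypeR R)))//.
under eq_bigr => i _.
  rewrite lebesgue_measure_itv /= lte_fin -EFinB.
  rewrite (_ : (if _ then _ else _) = (2 * r)%:E); last first.
    (* The second case is [r = 0], where the interval is a point and [2 * r] is still its length. *)
    case: ltP => [_|h]; congr EFin; lra.
  over.
by rewrite prodEFin prodr_const card_ord.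
Qed.

(* The region [a <= eps] gives the first term; elsewhere half of the exponent
   [c a^2 / d] is [>= c eps^2 / (2 d)] and the other half absorbs the factor [a]. *)
Lemma expR_tail_bound (c eps a u d : R) :
  0 < c -> 0 < eps -> 0 <= a -> 0 < d <= 1 -> c * a ^+ 2 <= u ->
  a * expR (- u / d) <= eps * expR (- u / d) +
    (1 + 4 / c) * expR (- (c * eps ^+ 2 / (2 * d))) * expR (- (c / 4 * a ^+ 2)).
Proof.
move=> c0 e0 a0 /andP[d0 d1] cau.
have K0 : 0 <= 1 + 4 / c by rewrite addr_ge0// divr_ge0// ltW.
have [ae|/ltW ea] := leP a eps.
  apply: ler_wpDr; first by rewrite !mulr_ge0// ?expR_ge0.
  by rewrite ler_wpM2r// expR_ge0.
apply: ler_wpDl; first by rewrite mulr_ge0// ?expR_ge0// ltW.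
have aK : a <= (1 + 4 / c) * expR (c / 4 * a ^+ 2).
  apply: (@le_trans _ _ ((1 + 4 / c) * (1 + c / 4 * a ^+ 2))); last first.
    by rewrite ler_wpM2l// expR_ge1Dx.
  (* The constant [1 + 4 / c] makes the product at least [1 + a ^+ 2], hence at least [a]. *)
  have -> : (1 + 4 / c) * (1 + c / 4 * a ^+ 2) =
      1 + a ^+ 2 + 4 / c + c / 4 * a ^+ 2 by field; rewrite gt_eqF.
  have : 0 <= 4 / c by rewrite divr_ge0// ltW.
  have : 0 <= c / 4 * a ^+ 2 by rewrite mulr_ge0 ?sqr_ge0// divr_ge0// ltW.
  have : 0 <= (a - 1) ^+ 2 by rewrite sqr_ge0.
  nra.
apply: (@le_trans _ _ ((1 + 4 / c) * expR (c / 4 * a ^+ 2) *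
    expR (- (c * eps ^+ 2 / (2 * d)) - c / 2 * a ^+ 2))).
  apply: ler_pM => //.
  (* After multiplication by [d], both [c * eps ^+ 2 / 2] and [c * a ^+ 2 * d / 2] are at most
     [c * a ^+ 2 / 2], by [eps <= a] and [d <= 1]. *)
  rewrite ler_expR -opprD mulNr lerN2 ler_pdivlMr// mulrDl.
  have -> : c * eps ^+ 2 / (2 * d) * d = c * eps ^+ 2 / 2 by field; rewrite gt_eqF.
  apply: le_trans cau.
  have ea2 : c * eps ^+ 2 <= c * a ^+ 2.
    by rewrite ler_pM2l// ler_pXn2r// nnegrE ?ltW.
  have : c * a ^+ 2 * d <= c * a ^+ 2.
    by rewrite ler_piMr// mulr_ge0 ?sqr_ge0// ltW.
  lra.
rewrite -!mulrA ler_wpM2l// -!expRD ler_expR; lra.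
Qed.

(** By continuity [psi < eta] on a cube around [p]; [V] is the volume of that cube, so it does not
    depend on [d]. *)
Lemma Rintegral_expR_lower_bound psi p (eta : R) :
  continuous psi -> psi p = 0 -> 0 < eta ->
  exists2 V : R, 0 < V & forall d, 0 < d ->
    mu.-integrable setT (fun y => (expR (- psi y / d))%:E) ->
    V * expR (- eta / d) <= \int[mu]_y expR (- psi y / d).
Proof.
move=> cpsi psip eta0.
have /nbhs_ballP[e/= e0 pe] : \forall y \near p, psi y < eta.
  have cp : psi y @[y --> p] --> (0 : R) by rewrite -psip; exact: cpsi.
  apply: (cp [set u | u < eta]).
  exact: lt_nbhsl.
(* Halving [e] keeps the closed cube inside the open ball. *)
pose r := e / 2; have r0 : 0 < r by rewrite divr_gt0.
set Q := [set y : 'rV[R]_n | forall i, y 0 i \in `[p 0 i - r, p 0 i + r]].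
have mQ : measurable Q.
  exact: (measurable_box
    (fun i => [set` `[p 0 i - r, p 0 i + r]] : set (measurableTypeR R))).
have muQ : mu Q = ((2 * r) ^+ n)%:E by apply: lebesgue_rV_cube; exact: ltW.
exists ((2 * r) ^+ n) => [|d d0 iW]; first by rewrite exprn_gt0// mulr_gt0.
have mW := measurable_int _ iW.
rewrite -lee_fin /Rintegral fineK; last exact: integrable_fin_num.
rewrite mulrC EFinM -muQ -integral_cst//.
apply: (@le_trans _ _ (\int[mu]_(y in Q) (expR (- psi y / d))%:E)%E); last first.
  by apply: ge0_subset_integral => // y _; rewrite lee_fin expR_ge0.
apply: ge0_le_integral => //.
- by move=> y _; rewrite lee_fin expR_ge0.
- exact: measurable_funTS.
- move=> y Qy; rewrite lee_fin ler_expR ler_pM2r ?invr_gt0// lerN2 ltW//.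
  apply: pe; split => // i j; rewrite (ord1 i).
  have := Qy j; rewrite in_itv/= => /andP[q1 q2].
  by rewrite /ball/= ltr_norml; apply/andP; split; rewrite /r in q1 q2; lra.
Qed.

End laplace.

(** * Concentration of the mean at the minimizer *)

Section laplace_mean.
Context {R : realType} {n : nat}.
Implicit Types y : 'rV[R]_n.
Local Notation mu := (@lebesgue_rV R n).

Variables (psi : 'rV[R]_n -> R) (p : 'rV[R]_n) (c : R).
Hypotheses (c0 : 0 < c) (cpsi : continuous psi).
Hypothesis psi_ge : forall y, c * enorm (y - p) ^+ 2 <= psi y.

Local Notation W d := (fun y => expR (- psi y / d)).
Local Notation G := (fun y => expR (- (c / 4 * enorm (y - p) ^+ 2))).

Let integrable_mull (k : R) (f : 'rV[R]_n -> R) :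
  mu.-integrable setT (EFin \o f) -> mu.-integrable setT (EFin \o (fun y => k * f y)).
Proof. by move=> /(integrableZl measurableT k). Qed.

Let integrable_add (f g : 'rV[R]_n -> R) :
  mu.-integrable setT (EFin \o f) -> mu.-integrable setT (EFin \o g) ->
  mu.-integrable setT (EFin \o (fun y => f y + g y)).
Proof. by move=> fi /(integrableD measurableT fi). Qed.

Let mW (d : R) : measurable_fun setT (W d).
Proof.
apply: measurableT_comp => //; apply: measurable_funM => //.
by apply: measurableT_comp => //; exact: continuous_measurable_fun_rV.
Qed.

Lemma integrable_expR_growth (d : R) : 0 < d ->
  mu.-integrable setT (EFin \o W d).
Proof.
move=> d0; have cd0 : 0 < c / d by rewrite divr_gt0.
apply: (le_integrable measurableT _ _ (integrable_gauss _ p cd0)) => //.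
  exact/measurable_EFinP.
move=> y _; rewrite /= lee_fin !ger0_norm ?expR_ge0// ler_expR mulNr lerN2.
by rewrite mulrAC ler_pM2r ?invr_gt0.
Qed.

Let moment_bound (eps d : R) y i : 0 < eps -> 0 < d <= 1 ->
  `|y 0 i - p 0 i| * W d y <= eps * W d y +
    (1 + 4 / c) * expR (- (c * eps ^+ 2 / (2 * d))) * G y.
Proof.
move=> e0 d01; apply: le_trans; last first.
  by apply: expR_tail_bound => //; exact: enorm_ge0.
rewrite ler_wpM2r ?expR_ge0// (le_trans _ (le_coord_enorm _ i))//.
by rewrite !mxE.
Qed.

Let int_bound (eps d : R) : 0 < d ->
  mu.-integrable setT (EFin \o (fun y => eps * W d y +
    (1 + 4 / c) * expR (- (c * eps ^+ 2 / (2 * d))) * G y)).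
Proof.
move=> d0; have iW := integrable_expR_growth _ d0.
have iG : mu.-integrable setT (EFin \o G) by apply: integrable_gauss; rewrite divr_gt0.
by apply: integrable_add; exact: integrable_mull.
Qed.

(** Domination by the right-hand side of [moment_bound] with [eps = 1]. *)
Lemma integrable_centered_moment (d : R) i : 0 < d <= 1 ->
  mu.-integrable setT (EFin \o (fun y => (y 0 i - p 0 i) * W d y)).
Proof.
move=> d01; have /andP[d0 d1] := d01.
apply: (le_integrable measurableT _ _ (int_bound 1 d d0)) => //.
  apply/measurable_EFinP; apply: measurable_funM => //.
  by apply: measurable_funB => //; exact: measurable_coord.
move=> y _; rewrite /= lee_fin normrM (ger0_norm (expR_ge0 _)).
exact: le_trans (moment_bound 1 d y i ltr01 d01) (ler_norm _).
Qed.

Lemma integrable_moment (d : R) i : 0 < d <= 1 ->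
  mu.-integrable setT (EFin \o (fun y => y 0 i * W d y)).
Proof.
move=> d01; have /andP[d0 d1] := d01.
rewrite (_ : (fun y => _) = (fun y => (y 0 i - p 0 i) * W d y + p 0 i * W d y)).
  apply: integrable_add; first exact: integrable_centered_moment.
  by apply: integrable_mull; exact: integrable_expR_growth.
by apply/funext => y; ring.
Qed.

Lemma laplace_mean (eps : R) : psi p = 0 -> 0 < eps -> \forall d \near 0^'+,
  forall i, `|p 0 i - (\int[mu]_y W d y)^-1 * \int[mu]_y (y 0 i * W d y)| <= eps.
Proof.
move=> psip eps0; pose e := eps / 2; have e0 : 0 < e by rewrite divr_gt0.
(* The tail decays like [expR (- (2 * eta / d))] while the total mass is at least
   [V * expR (- eta / d)], so their ratio still carries a factor [expR (- eta / d)]. *)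
pose eta := c * e ^+ 2 / 4.
have ce0 : 0 < c * e ^+ 2 by rewrite mulr_gt0// exprn_gt0.
have eta0 : 0 < eta by rewrite divr_gt0.
have [V V0 ZV] := Rintegral_expR_lower_bound psi p eta cpsi psip eta0.
(* The Gaussian [G] is free of [d], so [K] is a constant. *)
pose K := (1 + 4 / c) * \int[mu]_y G y.
have K0 : 0 <= K.
  rewrite mulr_ge0//; first by rewrite addr_ge0// divr_ge0// ltW.
  by apply: Rintegral_ge0 => y _; exact: expR_ge0.
(* The normalized tail will be at most [M * d], so [d <= e / (M + 1)] makes it at most [e]; the
   [+ 1] keeps the divisor positive when [M = 0]. *)
pose M := K / (V * eta).
have M0 : 0 <= M by rewrite divr_ge0// mulr_ge0// ltW.
have M10 : 0 < e / (M + 1) by rewrite divr_gt0// ltr_wpDl.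
near=> d => i.
have d0 : 0 < d by near: d; exact: nbhs_right_gt.
have d1 : d <= 1 by near: d; exact: nbhs_right_le.
have dM : d <= e / (M + 1) by near: d; exact: nbhs_right_le.
have d01 : 0 < d <= 1 by rewrite d0.
have iW := integrable_expR_growth d d0.
have iG : mu.-integrable setT (EFin \o G) by apply: integrable_gauss; rewrite divr_gt0.
have := ZV d d0 iW; set Z := \int[mu]_y W d y => ZVd.
have Z0 : 0 < Z by apply: lt_le_trans ZVd; rewrite mulr_gt0// expR_gt0.
(* Since [Z] is the total mass, the error of the mean is a normalized centred moment. *)
have -> : p 0 i - Z^-1 * \int[mu]_y (y 0 i * W d y) =
    - (\int[mu]_y ((y 0 i - p 0 i) * W d y) / Z).
  under [in RHS]eq_Rintegral do rewrite mulrBl.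
  rewrite RintegralB//; [|exact: integrable_moment|exact: integrable_mull].
  by rewrite RintegralZl// -/Z mulrBl mulfK ?gt_eqF// opprB mulrC.
rewrite normrN normrM (gtr0_norm (_ : 0 < Z^-1)) ?invr_gt0// ler_pdivrMr//.
have iM := integrable_centered_moment d i d01.
apply: le_trans (le_normr_Rintegral measurableT iM) _.
have iE := int_bound e d d0.
apply: (@le_trans _ _ (e * Z + K * expR (- (2 * eta / d)))).
  apply: (@le_trans _ _ (\int[mu]_y (e * W d y +
    (1 + 4 / c) * expR (- (c * e ^+ 2 / (2 * d))) * G y))).
    apply: le_Rintegral => //.
    - rewrite (_ : _ \o _ = abse \o (EFin \o (fun y => (y 0 i - p 0 i) * W d y)))//.
      exact: integrable_abse.
    - move=> y _; rewrite normrM (ger0_norm (expR_ge0 _)).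
      exact: moment_bound.
  rewrite RintegralD//; [|exact: integrable_mull|exact: integrable_mull].
  rewrite !RintegralZl// lerD2l /K /eta mulrAC.
  rewrite (_ : c * e ^+ 2 / (2 * d) = 2 * (c * e ^+ 2 / 4) / d)//.
  by field; rewrite gt_eqF.
(* One half of [eps] pays for the region near [p], the other for the tail. *)
have -> : eps * Z = e * Z + e * Z by rewrite /e; field.
rewrite lerD2l.
apply: (@le_trans _ _ (e * (V * expR (- eta / d)))); last by rewrite ler_pM2l.
have -> : expR (- (2 * eta / d)) = expR (- eta / d) * expR (- eta / d).
  by rewrite -expRD; congr expR; field; rewrite gt_eqF.
rewrite !mulrA ler_pM2r ?expR_gt0//.
(* From [eta / d <= expR (eta / d)], inverted. *)
apply: (@le_trans _ _ (K * (d / eta))).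
  rewrite ler_wpM2l// mulNr expRN -[leRHS]invrK.
  rewrite lef_pV2 ?posrE ?expR_gt0 ?invr_gt0 ?divr_gt0//.
  rewrite invf_div; apply: le_trans (expR_ge1Dx _); lra.
have -> : K * (d / eta) = M * d * V by rewrite /M; field; rewrite !gt_eqF.
rewrite ler_pM2r//.
move: dM; rewrite ler_pdivlMr ?ltr_wpDl// => /(le_trans _); apply.
rewrite mulrDr mulr1 mulrC lerDl; exact: ltW.
Unshelve. all: by end_near. Qed.

End laplace_mean.

(** * Gaussian expectations as Lebesgue integrals *)

Section normal_expectation_theory.
Context {R : realType} {n : nat}.
Local Notation mu := (@lebesgue_rV R n).

(** The integrals agree in the extended reals, so their real values agree too, default value
    included. *)
Lemma normal_expectationE (x : 'rV[R]_n) (v : R) (g : 'rV[R]_n -> R) :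
  measurable_fun setT g ->
  normal_expectation x v g = \int[mu]_y (g y * normal_rV_pdf x v y).
Proof.
move=> mg; rewrite /normal_expectation /Rintegral.
rewrite (@integral_density _ _ R mu (normal_rV x v) (normal_rV_pdf x v))//.
- by move=> y; exact: normal_rV_pdf_ge0.
- exact: measurable_normal_rV_pdf.
- exact/measurable_EFinP.
Qed.

(** The variance [d * t] puts the Gaussian exponent on the scale [d^-1] of [f]. The shift [m], later
    the minimum, only changes the prefactor, which is constant in [y]. *)
Lemma expR_normal_rV_pdf (f : 'rV[R]_n -> R) (x y : 'rV[R]_n) (t d m : R) :
  0 < t -> 0 < d ->
  expR (- f y / d) * normal_rV_pdf x (d * t) y =
  (2 * pi * (d * t)) `^ (- (n%:R / 2)) * expR (- m / d) *
  expR (- (prox_objective t f x y - m) / d).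
Proof.
move=> t0 d0; rewrite /normal_rV_pdf mulrCA -!mulrA -!expRD.
by congr (_ * expR _); rewrite /prox_objective; field; rewrite !gt_eqF.
Qed.

End normal_expectation_theory.

(** * The proximal point and the limit of the quotient *)

Theorem theorem1 (R : realType) (n : nat) (f : 'rV[R]_n -> R) (rho L : R)
    (rho_gt0 : 0 < rho) (f_wc : weakly_convex rho f)
    (L_gt0 : 0 < L) (f_reg : L_smooth L f \/ L_lipschitz L f)
    (x : 'rV[R]_n) (t : R) (t_gt0 : 0 < t) (t_lt : t < 1 / rho) :
  exists p : 'rV[R]_n,
    prox t f x = [set p] /\
    (0 <= moreau_envelope f x t ->
     (normal_expectation x (delta * t) (fun y => expR (- f y / delta)))^-1 *:
       normal_expectation_rV x (delta * t) (fun y => expR (- f y / delta) *: y)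
       @[delta --> 0^'+] --> p).
Proof.
have cf : continuous f.
  case: f_reg => [[df _] y|/L_lipschitz_continuous//].
  exact: differentiable_continuous.
pose phi := prox_objective t f x; pose c := (t^-1 - rho) / 2.
have c0 : 0 < c.
  rewrite divr_gt0// subr_gt0 -[ltLHS]invrK ltf_pV2 ?posrE ?invr_gt0//.
  by rewrite -div1r.
have cphi : continuous phi by exact: continuous_prox_objective.
have scphi : strongly_convex c phi by exact: strongly_convex_prox_objective.
have [p pmin] := strongly_convex_argmin c phi x c0 cphi scphi.
have growth := strongly_convex_growth c phi p scphi pmin.
have c20 : 0 < c / 2 by rewrite divr_gt0.
exists p; split.
  apply/seteqP; split=> [z zmin /=|_ -> //].
  (* Quadratic growth at another minimizer [z] forces [enorm (z - p) ^+ 2 <= 0]. *)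
  apply/eqP; rewrite -subr_eq0; apply/eqP/enorm_eq0/eqP; rewrite -sqrf_eq0.
  rewrite eq_le sqr_ge0 andbT -(pmulr_rle0 _ c20).
  by rewrite -(lerD2l (phi p)) addr0 (le_trans (growth z))//; exact: zmin.
move=> _; pose psi y := phi y - phi p.
have cpsi : continuous psi.
  move=> y; apply: (cvgB (F := nbhs y)); first exact: cphi.
  exact: cvg_cst.
have psi_ge y : c / 2 * enorm (y - p) ^+ 2 <= psi y by rewrite lerBrDl.
have psip : psi p = 0 by rewrite /psi subrr.
have mexp (d : R) : measurable_fun setT (fun y => expR (- f y / d)).
  apply: measurableT_comp => //; apply: measurable_funM => //.
  by apply: measurableT_comp => //; exact: continuous_measurable_fun_rV.
apply/cvgrPdist_le => e e0.
near=> d.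
have d0 : 0 < d by near: d; exact: nbhs_right_gt.
have d1 : d <= 1 by near: d; exact: nbhs_right_le.
have d01 : 0 < d <= 1 by rewrite d0.
(* The common prefactor of numerator and denominator; being nonzero, it cancels in the quotient. *)
set A := (2 * pi * (d * t)) `^ (- (n%:R / 2)) * expR (- phi p / d).
have A0 : 0 < A by rewrite mulr_gt0 ?expR_gt0// powR_gt0// !mulr_gt0// pi_gt0.
have AE y := expR_normal_rV_pdf f x y t d (phi p) t_gt0 d0.
apply: le_mx_norm_coord => [|i]; first exact: ltW.
rewrite !mxE normal_expectationE//.
under eq_Rintegral do rewrite AE.
rewrite RintegralZl//; last exact: integrable_expR_growth c20 cpsi psi_ge d d0.
rewrite normal_expectationE; last first.
  under eq_fun do rewrite mxE.
  by apply: measurable_funM => //; exact: measurable_coord.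
have -> : \int[@lebesgue_rV R n]_y
    ((expR (- f y / d) *: y) 0 i * normal_rV_pdf x (d * t) y) =
  A * \int[@lebesgue_rV R n]_y (y 0 i * expR (- psi y / d)).
  rewrite -RintegralZl//; last exact: integrable_moment c20 cpsi psi_ge d i d01.
  by apply: eq_Rintegral => y _; rewrite mxE mulrAC AE -/A; ring.
rewrite invfM mulrACA mulVf ?gt_eqF// mul1r.
(* The bound of [laplace_mean] holds for all coordinates at once, so one threshold on [d] serves
   every [i]. *)
move: i; near: d.
exact: laplace_mean c20 cpsi psi_ge e psip e0.
Unshelve. all: by end_near. Qed.
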